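(* Let $R$ be an algebraically closed field. (1) For every $n\ge 1$ and every $c\in M_n(R)$, the algebra $S_n(c,R)=\{a\in M_n(R)\mid ac=ca\}$ is a cellular $R$-algebra. (2) If $c\in\Lambda:=M_{n_1}(R)\times M_{n_2}(R)\times\cdots\times M_{n_s}(R)$ with $n_i\ge1$ for all $1\le i\le s$, then $S(c,\Lambda)=\{a\in\Lambda\mid ac=ca\}$ is a cellular $R$-algebra.
   Context: Cellular algebra (Graham–Lehrer): let $R$ be a commutative ring with identity. A unitary $R$-algebra $A$ is cellular with cell datum $(P,M,C,\iota)$ if: (C1) $P$ is a finite partially ordered set, and to each $p\in P$ is associated a finite set $M(p)$ such that $\{C^p_{ij}\mid p\in P,\ i,j\in M(p)\}$ is an $R$-basis of $A$; (C2) $\iota:A\to A$ is an $R$-linear anti-automorphism with $\iota^2=\mathrm{id}$ that sends $C^p_{ij}$ to $C^p_{ji}$; (C3) for $a\in A$, $p\in P$, $i,j\in M(p)$, one has $aC^p_{ij}=\sum_{u\in M(p)}r_a(u,i)C^p_{uj}+r'$, where $r_a(u,i)\in R$ does not depend on $j$ and $r'$ is an $R$-linear combination of basis elements $C^q_{st}$ with $q$ strictly smaller than $p$. An algebra is cellular if it has some cell datum. *)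

(* Defs.v *)
From HB Require Import structures.
From mathcomp Require Import all_boot all_order all_algebra.

Set Implicit Arguments.
Unset Strict Implicit.
Unset Printing Implicit Defensive.

Import Order.TTheory GRing.Theory.
Local Open Scope ring_scope.

Section Cellular.

Variables (R : comNzRingType) (A : algType R).

Section CellDatum.

Variables (d : Order.disp_t) (P : finPOrderType d) (M : P -> finType).
Variables (C : forall p : P, M p -> M p -> A) (iota : {linear A -> A}).

Definition cell_lincomb (Q : pred P) (k : forall p : P, M p -> M p -> R) : A :=
  \sum_(p | Q p) \sum_(i : M p) \sum_(j : M p) k p i j *: C i j.

(* A basis in the sense of indexed families: in particular the C^p_ij are
   pairwise distinct. *)
Definition cell_basis : Prop :=
  (forall a : A, exists k, a = cell_lincomb predT k) /\
  (forall k, cell_lincomb predT k = 0 ->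
     forall (p : P) (i j : M p), k p i j = 0).

(* An involution is bijective, so antimultiplicativity makes the linear map
   iota an anti-automorphism (and forces iota 1 = 1). *)
Definition cell_involution : Prop :=
  [/\ forall a b : A, iota (a * b) = iota b * iota a,
      forall a : A, iota (iota a) = a
    & forall (p : P) (i j : M p), iota (C i j) = C j i].

Definition cell_left_mult : Prop :=
  forall (a : A) (p : P), exists r : M p -> M p -> R,
    forall i j : M p, exists k,
      a * C i j =
      \sum_(u : M p) r u i *: C u j + cell_lincomb [pred q | (q < p)%O] k.

Definition is_cell_datum : Prop :=
  [/\ cell_basis, cell_involution & cell_left_mult].

End CellDatum.

Definition cellular : Prop :=
  exists (d : Order.disp_t) (P : finPOrderType d) (M : P -> finType)
    (C : forall p : P, M p -> M p -> A) (iota : {linear A -> A}),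
    is_cell_datum C iota.

End Cellular.

Section Centralizer.

Variables (R : comNzRingType) (A : algType R) (c : A).

Definition centralizes : {pred A} := fun a => a * c == c * a.

Fact centralizes_subalg_closed : subalg_closed centralizes.
Proof.
split=> [|k a b|a b]; rewrite !unfold_in ?mul1r ?mulr1 //.
  move=> /eqP ac /eqP bc.
  by rewrite mulrDl mulrDr -scalerAl -scalerAr ac bc.
by move=> /eqP ac /eqP bc; rewrite -mulrA bc mulrA ac mulrA.
Qed.

HB.instance Definition _ :=
  GRing.isSubalgClosed.Build R A centralizes centralizes_subalg_closed.

Record centralizer : Type := Centralizer {
  centralizer_val :> A;
  centralizerP : centralizer_val \in centralizes
}.

HB.instance Definition _ := [isSub for centralizer_val].
HB.instance Definition _ := [Choice of centralizer by <:].
HB.instance Definition _ := [SubChoice_isSubAlgebra of centralizer by <:].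

End Centralizer.

(* Direct product of s + 1 algebras; the library's rings of finite functions
   do not cover dependent families, and an algType must satisfy 1 != 0, whence
   the nonempty index type. *)
Section AlgProd.

Variables (R : comNzRingType) (s : nat) (A : 'I_s.+1 -> algType R).

Definition alg_prod : Type := {dffun forall i : 'I_s.+1, A i}.

HB.instance Definition _ := Choice.on alg_prod.

Implicit Types f g h : alg_prod.

Definition alg_prod_fun f : forall i, A i := fun_of_fin f.
Definition alg_prod_of (f : forall i, A i) : alg_prod := finfun f.

Lemma alg_prodE (f : forall i, A i) i : alg_prod_fun (alg_prod_of f) i = f i.
Proof. exact: ffunE. Qed.

Lemma alg_prodP f g : (forall i, alg_prod_fun f i = alg_prod_fun g i) <-> f = g.
Proof. exact: ffunP. Qed.

Definition alg_prod_zero : alg_prod := alg_prod_of (fun i => 0).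
Definition alg_prod_one : alg_prod := alg_prod_of (fun i => 1).
Definition alg_prod_opp f : alg_prod :=
  alg_prod_of (fun i => - alg_prod_fun f i).
Definition alg_prod_add f g : alg_prod :=
  alg_prod_of (fun i => alg_prod_fun f i + alg_prod_fun g i).
Definition alg_prod_mul f g : alg_prod :=
  alg_prod_of (fun i => alg_prod_fun f i * alg_prod_fun g i).
Definition alg_prod_scale (k : R) f : alg_prod :=
  alg_prod_of (fun i => k *: alg_prod_fun f i).

Local Ltac pointwise := apply/alg_prodP=> i; rewrite !alg_prodE.

Fact alg_prod_addA : associative alg_prod_add.
Proof. by move=> f g h; pointwise; rewrite addrA. Qed.
Fact alg_prod_addC : commutative alg_prod_add.
Proof. by move=> f g; pointwise; rewrite addrC. Qed.
Fact alg_prod_add0 : left_id alg_prod_zero alg_prod_add.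
Proof. by move=> f; pointwise; rewrite add0r. Qed.
Fact alg_prod_addN : left_inverse alg_prod_zero alg_prod_opp alg_prod_add.
Proof. by move=> f; pointwise; rewrite addNr. Qed.

HB.instance Definition _ := GRing.isZmodule.Build alg_prod
  alg_prod_addA alg_prod_addC alg_prod_add0 alg_prod_addN.

Fact alg_prod_mulA : associative alg_prod_mul.
Proof. by move=> f g h; pointwise; rewrite mulrA. Qed.
Fact alg_prod_mul1l : left_id alg_prod_one alg_prod_mul.
Proof. by move=> f; pointwise; rewrite mul1r. Qed.
Fact alg_prod_mul1r : right_id alg_prod_one alg_prod_mul.
Proof. by move=> f; pointwise; rewrite mulr1. Qed.
Fact alg_prod_mulDl : left_distributive alg_prod_mul +%R.
Proof. by move=> f g h; pointwise; rewrite mulrDl. Qed.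
Fact alg_prod_mulDr : right_distributive alg_prod_mul +%R.
Proof. by move=> f g h; pointwise; rewrite mulrDr. Qed.
Fact alg_prod_1neq0 : alg_prod_one != 0.
Proof.
apply/eqP=> /alg_prodP /(_ ord0) /eqP.
by rewrite !alg_prodE oner_eq0.
Qed.

HB.instance Definition _ := GRing.Zmodule_isNzRing.Build alg_prod
  alg_prod_mulA alg_prod_mul1l alg_prod_mul1r alg_prod_mulDl alg_prod_mulDr
  alg_prod_1neq0.

Fact alg_prod_scaleA k l f :
  alg_prod_scale k (alg_prod_scale l f) = alg_prod_scale (k * l) f.
Proof. by pointwise; rewrite scalerA. Qed.
Fact alg_prod_scale1 : left_id 1 alg_prod_scale.
Proof. by move=> f; pointwise; rewrite scale1r. Qed.
Fact alg_prod_scaleDr : right_distributive alg_prod_scale +%R.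
Proof. by move=> k f g; pointwise; rewrite scalerDr. Qed.
Fact alg_prod_scaleDl f : {morph alg_prod_scale^~ f : k l / k + l}.
Proof. by move=> k l; pointwise; rewrite scalerDl. Qed.

HB.instance Definition _ := GRing.Zmodule_isLmodule.Build R alg_prod
  alg_prod_scaleA alg_prod_scale1 alg_prod_scaleDr alg_prod_scaleDl.

Fact alg_prod_scaleAl k f g : k *: (f * g) = (k *: f) * g.
Proof. by pointwise; rewrite scalerAl. Qed.

HB.instance Definition _ :=
  GRing.Lmodule_isLalgebra.Build R alg_prod alg_prod_scaleAl.

Fact alg_prod_scaleAr k f g : k *: (f * g) = f * (k *: g).
Proof. by pointwise; rewrite scalerAr. Qed.

HB.instance Definition _ :=
  GRing.Lalgebra_isAlgebra.Build R alg_prod alg_prod_scaleAr.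

End AlgProd.

(* Main.v *)
(* Over an algebraically closed field, c has a Jordan basis with blocks of sizes
   l i and eigenvalues mu i.  Among blocks with a common eigenvalue, the
   commutant has as basis the maps which factor from block i to block j through
   K[x]/(x^m) for m <= min (l i) (l j), by the canonical quotient and inclusion.
   These are the cells, ordered by m: composing
   such a map with any element of the commutant produces either the same m, with
   a coefficient that sees only one index, or smaller ones.  Reversing each
   Jordan block and transposing is the involution.

   The Jordan basis is obtained together with its dual basis: for an idempotent
   e commuting with c, a row v and a column f are chosen with
   v (c - mu)^m f <> 0 where v (c - mu)^(m+1) = 0 and (c - mu)^(m+1) f = 0; they
   span a block together with its idempotent, which is split off from e.

   For products, the index set of the cells is the disjoint union of those of
   the factors. *)

From HB Require Import structures.
Require Import Defs.
From mathcomp Require Import all_boot all_order all_algebra zify.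

Set Implicit Arguments.
Unset Strict Implicit.
Unset Printing Implicit Defensive.

Import Order.TTheory GRing.Theory.
Local Open Scope ring_scope.

(** * Cell data of products *)

(* Axiom (C3) only becomes weaker when the order gains strict relations, so it
   is enough to compare ranks. *)
Definition ranked (T : finType) (r : T -> nat) : Type := T.

Section Ranked.

Variables (T : finType) (r : T -> nat).
Local Notation ranked := (ranked r).

HB.instance Definition _ := Finite.on ranked.

Definition ranked_le : rel ranked := fun x y => (x == y) || (r x < r y)%N.
Definition ranked_lt : rel ranked := fun x y => (r x < r y)%N.

Fact ranked_lt_def x y : ranked_lt x y = (y != x) && ranked_le x y.
Proof.
by rewrite /ranked_le /ranked_lt; case: (eqVneq x y) => [->|]; rewrite ?ltnn.
Qed.

Fact ranked_le_refl : reflexive ranked_le.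
Proof. by move=> x; rewrite /ranked_le eqxx. Qed.

Fact ranked_le_anti : antisymmetric ranked_le.
Proof.
move=> x y; rewrite /ranked_le => /andP[/predU1P[->//|xy] /predU1P[->//|yx]].
by move: (ltn_trans xy yx); rewrite ltnn.
Qed.

Fact ranked_le_trans : transitive ranked_le.
Proof.
move=> y x z; rewrite /ranked_le => /predU1P[->//|xy] /predU1P[<-|yz].
  by rewrite xy orbT.
by rewrite (ltn_trans xy yz) orbT.
Qed.

HB.instance Definition _ := Order.isPOrder.Build (Order.Disp tt tt) ranked
  ranked_lt_def ranked_le_refl ranked_le_anti ranked_le_trans.

End Ranked.

Section Product.

Variables (R : comNzRingType) (A : algType R) (I : finType) (B : I -> algType R).
Variables (proj : forall i, {linear A -> B i}) (inj : forall i, {linear B i -> A}).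
Hypothesis projM : forall i a b, proj i (a * b) = proj i a * proj i b.
Hypothesis injK : forall i, cancel (inj i) (proj i).
Hypothesis proj_inj0 : forall i j b, i != j -> proj i (inj j b) = 0.
Hypothesis sum_inj_proj : forall a, \sum_i inj i (proj i a) = a.

Lemma proj_ext a b : (forall i, proj i a = proj i b) -> a = b.
Proof.
move=> ab; rewrite -(sum_inj_proj a) -(sum_inj_proj b).
by apply: eq_bigr => i _; rewrite ab.
Qed.

Lemma mul_inj a i b : a * inj i b = inj i (proj i a * b).
Proof.
apply: proj_ext => j; rewrite projM.
have [->|ij] := eqVneq j i; first by rewrite !injK.
by rewrite !proj_inj0 // mulr0.
Qed.

(** By [mul_inj], an element [a] acts on the image of the factor [i] through [proj i a], so each
    axiom can be checked one factor at a time. *)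
Lemma cellular_product : (forall i, cellular (B i)) -> cellular A.
Proof.
move=> cellB.
have [d] := fin_all_exists cellB => {cellB}.
move=> /fin_all_exists[P] /fin_all_exists[M] /fin_all_exists[C] /fin_all_exists[io dat].
pose T : finType := {i : I & P i}.
(* Counting the elements strictly below, within the same factor, gives a rank that increases
   strictly along each [P i]. *)
pose r (x : T) := #|[pred q : P (tag x) | (q < tagged x)%O]|.
pose M' (x : ranked r) := M _ (tagged (x : T)).
pose C' (x : ranked r) (k l : M' x) := inj _ (C _ _ k l).
pose ioT (a : A) := \sum_i inj i (io i (proj i a)).
have ioT_lin : linear ioT.
  move=> k a b; rewrite /ioT scaler_sumr -big_split /=; apply: eq_bigr => i _.
  by rewrite !linearP.
pose ioTl : {linear A -> A} := HB.pack ioT (GRing.isLinear.Build _ _ _ _ ioT ioT_lin).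
have proj_ioT i a : proj i (ioT a) = io i (proj i a).
  rewrite raddf_sum /= (bigD1 i) //= injK big1 ?addr0 // => j ji.
  by rewrite proj_inj0 // eq_sym.
have lincomb_inj (k : forall x, M' x -> M' x -> R) (Q : pred (ranked r)) :
   cell_lincomb C' Q k =
     \sum_i inj i
       (cell_lincomb (C i) [pred p | Q (Tagged P p)] (fun p => k (Tagged P p))).
  rewrite /cell_lincomb.
  under [RHS]eq_bigr => i _ do rewrite raddf_sum.
  rewrite [RHS]sig_big_dep /=; apply: eq_big => [[i p]|[i p] _] //=.
  do 2![rewrite raddf_sum; apply: eq_bigr => ? _].
exact: esym (linearZ_LR (inj i) _ _).
have proj_lincomb (k : forall x, M' x -> M' x -> R) Q i :
   proj i (cell_lincomb C' Q k) =
     cell_lincomb (C i) [pred p | Q (Tagged P p)] (fun p => k (Tagged P p)).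
  rewrite lincomb_inj raddf_sum /= (bigD1 i) //= injK big1 ?addr0 // => j ji.
  by rewrite proj_inj0 // eq_sym.
exists (Order.Disp tt tt), (ranked r), M', C', ioTl; split.
- split=> [a|k k0 [i p] x y].
    have spanP i : exists k, proj i a = cell_lincomb (C i) predT k.
      by have [[+ _] _ _] := dat i; apply.
    have [k Ek] := fin_all_exists spanP.
    exists (fun x => k (tag x) (tagged x)); rewrite lincomb_inj -[LHS]sum_inj_proj.
    by apply: eq_bigr => i _; rewrite Ek.
  have [[_ indep] _ _] := dat i.
  apply: (indep (fun p => k (Tagged P p))).
by have := congr1 (proj i) k0; rewrite proj_lincomb raddf0.
- split=> [a b|a|[i p] x y] /=.
  + apply: proj_ext => i; rewrite projM !proj_ioT projM.
    by have [_ [+ _ _] _] := dat i; apply.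
  + apply: proj_ext => i; rewrite !proj_ioT.
    by have [_ [_ + _] _] := dat i; apply.
  + apply: proj_ext => j; rewrite proj_ioT.
    have [->|ji] := eqVneq j i; last by rewrite !proj_inj0 // raddf0.
    by rewrite !injK; have [_ [_ _ +] _] := dat i; apply.
move=> a [i p]; have [_ _ /(_ (proj i a) p)[u Eu]] := dat i.
exists u => x y; have [k Ek] := Eu x y.
(* The rank order may also admit elements of [P i] that are not below [p], and elements of other
   factors; [k0] and [k1] put zero coefficients there. *)
pose k0 (q : P i) : M i q -> M i q -> R := if (q < p)%O then k q else fun _ _ => 0.
pose k1 := dfwith (fun j (q : P j) (_ _ : M j q) => 0 : R) k0.
exists (fun z => k1 (tag z) (tagged z)).
rewrite mul_inj /= Ek raddfD raddf_sum /=; congr (_ + _).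
  by apply: eq_bigr => z _; rewrite linearZ.
rewrite lincomb_inj (bigD1 i) //= big1 ?addr0 => [|j ji]; last first.
  rewrite (_ : cell_lincomb _ _ _ = 0) ?raddf0 //.
  rewrite /cell_lincomb big1 // => q _; rewrite big1 // => s _; rewrite big1 // => t _.
  by rewrite /k1 dfwith_out 1?eq_sym // scale0r.
congr (inj i _); rewrite /cell_lincomb big_mkcond [RHS]big_mkcond /=.
apply: eq_bigr => q _; rewrite /k1 dfwith_in /k0.
have [qp|qp] := boolP (q < p)%O.
  rewrite ifT //; apply: proper_card; apply/properP; split.
    by apply/subsetP => s; rewrite !inE => /lt_trans; apply.
  by exists q; rewrite !inE ?ltxx.
by case: ifP => // _; rewrite big1 // => s _; rewrite big1 // => t _; rewrite scale0r.
Qed.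

End Product.

(** * Centralizers in direct products of algebras *)

Section CentralizerProduct.

Variables (R : comNzRingType) (s : nat) (A : 'I_s.+1 -> algType R) (c : alg_prod A).
Local Notation cf := (alg_prod_fun c).

Lemma centralizer_alg_prodP (f : alg_prod A) :
  (f \in centralizes c) <-> forall i, alg_prod_fun f i \in centralizes (cf i).
Proof.
rewrite unfold_in; split=> [/eqP/alg_prodP fc i|fc].
  by move: (fc i); rewrite !alg_prodE unfold_in => ->.
by apply/eqP/alg_prodP => i; rewrite !alg_prodE; apply/eqP; exact: fc i.
Qed.

Definition centralizer_proj i (a : centralizer c) : centralizer (cf i) :=
  Centralizer (iffLR (centralizer_alg_prodP _) (centralizerP a) i).

Fact centralizer_proj_linear i : linear (@centralizer_proj i).
Proof. by move=> k a b; apply: val_inj; rewrite /= !alg_prodE. Qed.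

HB.instance Definition _ i := GRing.isLinear.Build R (centralizer c)
  (centralizer (cf i)) _ (@centralizer_proj i) (@centralizer_proj_linear i).

Definition alg_prod_inj i (b : A i) : alg_prod A := alg_prod_of (dfwith (fun=> 0) b).

Lemma alg_prod_inj_in i (b : A i) : alg_prod_fun (alg_prod_inj b) i = b.
Proof. by rewrite alg_prodE dfwith_in. Qed.

Lemma alg_prod_inj_out i j (b : A i) : i != j -> alg_prod_fun (alg_prod_inj b) j = 0.
Proof. by move=> ij; rewrite alg_prodE dfwith_out. Qed.

Fact alg_prod_inj_centralizes i (b : centralizer (cf i)) :
  alg_prod_inj (val b) \in centralizes c.
Proof.
apply/centralizer_alg_prodP => j; have [<-|ij] := eqVneq i j.
  by rewrite alg_prod_inj_in; exact: centralizerP.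
by rewrite alg_prod_inj_out // unfold_in mulr0 mul0r.
Qed.

Definition centralizer_inj i (b : centralizer (cf i)) : centralizer c :=
  Centralizer (alg_prod_inj_centralizes b).

Fact centralizer_inj_linear i : linear (@centralizer_inj i).
Proof.
move=> k a b; apply/val_inj/alg_prodP => j /=; rewrite !alg_prodE.
by have [<-|ij] := eqVneq i j; rewrite ?dfwith_in // !dfwith_out // scaler0 addr0.
Qed.

HB.instance Definition _ i := GRing.isLinear.Build R (centralizer (cf i))
  (centralizer c) _ (@centralizer_inj i) (@centralizer_inj_linear i).

Lemma cellular_centralizer_alg_prod :
  (forall i, cellular (centralizer (cf i))) -> cellular (centralizer c).
Proof.
apply: (cellular_product (proj := fun i => @centralizer_proj i : {linear _ -> _})
                         (inj := fun i => @centralizer_inj i : {linear _ -> _})).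
- by move=> i a b; apply: val_inj; rewrite /= alg_prodE.
- by move=> i b; apply: val_inj; rewrite /= alg_prod_inj_in.
- by move=> i j b ij; apply: val_inj; rewrite /= alg_prod_inj_out // eq_sym.
move=> a; apply/val_inj; rewrite raddf_sum /=; apply/alg_prodP => j.
have funD : {morph (@alg_prod_fun _ _ A)^~ j : f g / f + g >-> f + g}.
  by move=> f g; rewrite alg_prodE.
rewrite (big_morph _ funD (alg_prodE _ _)) (bigD1 j) //= alg_prod_inj_in.
by rewrite big1 ?addr0 // => i ij; rewrite alg_prod_inj_out.
Qed.

End CentralizerProduct.

(** * Jordan chains with their duals *)

Section JordanChain.

Variables (K : fieldType) (n : nat) (c : 'M[K]_n.+1).
Local Notation h := (horner_mx c).
Local Notation X_ mu := ('X - mu%:P).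

(* The rows v (c - mu)^a and the columns (c - mu)^(l - 1 - a) f, a < l, form
   dual bases of a Jordan block of c and of its dual. *)
Record jordan_chain (mu : K) (l : nat) (v : 'rV[K]_n.+1)
    (f : 'cV[K]_n.+1) : Prop :=
  JordanChain {
    chain_row0 : v *m h (X_ mu ^+ l) = 0;
    chain_col0 : h (X_ mu ^+ l) *m f = 0;
    chain_pair : forall s, v *m h (X_ mu ^+ s) *m f = (s.+1 == l)%:R%:M
  }.

(** The exponents in each summand add up to [l - 1], so each column meets its dual row and the sum
    is the projection onto the span of the columns. *)
Definition chain_idem (mu : K) (l : nat) (v : 'rV[K]_n.+1) (f : 'cV[K]_n.+1) :=
  \sum_(a < l) h (X_ mu ^+ (l - a.+1)) *m f *m (v *m h (X_ mu ^+ a)).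

Lemma horner_mxM (p q : {poly K}) : h (p * q) = h p *m h q.
Proof. by rewrite rmorphM. Qed.

Lemma horner_mxC (p q : {poly K}) : h p *m h q = h q *m h p.
Proof. by rewrite -!horner_mxM mulrC. Qed.

Lemma chain_row_ge0 mu l v f s :
  jordan_chain mu l v f -> (l <= s)%N -> v *m h (X_ mu ^+ s) = 0.
Proof.
by case=> v0 _ _ /subnKC <-; rewrite exprD horner_mxM mulmxA v0 mul0mx.
Qed.

Lemma chain_col_ge0 mu l v f s :
  jordan_chain mu l v f -> (l <= s)%N -> h (X_ mu ^+ s) *m f = 0.
Proof.
by case=> _ f0 _ /subnK <-; rewrite exprD horner_mxM -mulmxA f0 mulmx0.
Qed.

Lemma chain_idem_row mu l v f :
  jordan_chain mu l v f -> v *m chain_idem mu l v f = v.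
Proof.
case=> v0 f0 vf; rewrite /chain_idem mulmx_sumr.
case: l v0 f0 vf => [|l] v0 f0 vf.
  by move: v0; rewrite expr0 rmorph1 mulmx1 => ->; rewrite big_ord0.
rewrite big_ord_recl big1 => [|a _].
  by rewrite !mulmxA vf subn1 eqxx mul_scalar_mx scale1r expr0 rmorph1 mulmx1 addr0.
rewrite !mulmxA vf; case: eqP => [e|_]; last by rewrite mul_scalar_mx scale0r mul0mx.
by move: e (ltn_ord a); rewrite lift0; lia.
Qed.

Lemma chain_idem_col mu l v f :
  jordan_chain mu l v f -> chain_idem mu l v f *m f = f.
Proof.
case=> v0 f0 vf; rewrite /chain_idem mulmx_suml.
case: l v0 f0 vf => [|l] v0 f0 vf.
  by move: f0; rewrite expr0 rmorph1 mul1mx => ->; rewrite big_ord0.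
rewrite big_ord_recr big1 /= => [|a _].
  by rewrite -!mulmxA (mulmxA v) vf eqxx mulmx1 subnn expr0 rmorph1 mul1mx add0r.
rewrite -!mulmxA (mulmxA v) vf.
case: eqP => [[e]|_]; last by rewrite mul_mx_scalar scale0r mulmx0.
by move: (ltn_ord a); rewrite e ltnn.
Qed.

(** Multiplication by [c - mu] on either side gives the same sum up to a shift of the index: on the
    right the last term dies by [chain_row0], on the left the first one by [chain_col0]. *)
Lemma chain_idem_comm mu l v f :
  jordan_chain mu l v f -> chain_idem mu l v f *m c = c *m chain_idem mu l v f.
Proof.
move=> ch.
suff E : chain_idem mu l v f *m h (X_ mu) = h (X_ mu) *m chain_idem mu l v f.
  move: E; rewrite rmorphB /= horner_mx_X horner_mx_C mulmxBr mulmxBl.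
  by rewrite scalar_mxC => /addIr.
rewrite /chain_idem mulmx_suml mulmx_sumr.
case: l ch => [|l] ch; first by rewrite !big_ord0.
rewrite big_ord_recr [RHS]big_ord_recl /=.
rewrite -!mulmxA -horner_mxM -exprSr (chain_row0 ch) !mulmx0 addr0.
rewrite (mulmxA (h (X_ mu))) -horner_mxM -exprS !mulmxA subn1 (chain_col0 ch).
rewrite !mul0mx add0r; apply: eq_bigr => a _.
rewrite -!mulmxA -horner_mxM -exprSr (mulmxA (h _) (h _)) -horner_mxM -exprS.
by rewrite /bump leq0n add1n !subSS subnSK.
Qed.

Lemma horner_mx_commr (e : 'M[K]_n.+1) (ec : e *m c = c *m e) (p : {poly K}) :
  e *m h p = h p *m e.
Proof. exact: comm_mx_horner. Qed.

Lemma chain_idem_idem mu l v f : jordan_chain mu l v f ->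
  chain_idem mu l v f *m chain_idem mu l v f = chain_idem mu l v f.
Proof.
move=> ch; rewrite {1}/chain_idem mulmx_suml; apply: eq_bigr => a _.
rewrite -!mulmxA -(horner_mx_commr (chain_idem_comm ch)).
by rewrite (mulmxA v) chain_idem_row.
Qed.

End JordanChain.

(** * Splitting an idempotent of the commutant into Jordan chains *)

Section JordanSystem.

Variables (K : closedFieldType) (n : nat) (c : 'M[K]_n.+1).
Local Notation h := (horner_mx c).
Local Notation X_ mu := ('X - mu%:P).

(** Starting from the characteristic polynomial, lower the multiplicity of some root as long as the
    result still annihilates [e]. This stops before a nonzero constant is reached, because
    [e != 0]. *)
Lemma annihilator_split (e : 'M[K]_n.+1) : e != 0 ->
  exists mu m (q : {poly K}), [/\ coprimep q (X_ mu),
    h (q * X_ mu ^+ m.+1) *m e = 0 & h (q * X_ mu ^+ m) *m e != 0].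
Proof.
move=> e0; have [N] := ubnP (size (char_poly c)).
have := Cayley_Hamilton c; have := monic_neq0 (char_poly_monic c).
move: (char_poly c) => p p0 hp; have {hp} : h p *m e = 0 by rewrite hp mul0mx.
elim: N => // N IH in p p0 *; move=> pe sp.
have [/size_poly1P[k k0 pk]|/closed_rootP[mu rmu]] := boolP (size p == 1%N).
  move: pe; rewrite pk horner_mx_C mul_scalar_mx => /eqP.
  by rewrite scaler_eq0 (negbTE k0) (negbTE e0).
have [[|m] [q + pq]] := multiplicity_XsubC p mu; rewrite p0 /= => qmu.
  by rewrite pq expr0 mulr1 (negbTE qmu) in rmu.
have [E|E] := eqVneq (h (q * X_ mu ^+ m) *m e) 0; last first.
  by exists mu, m, q; split; rewrite -?pq // coprimep_XsubC.
have q0 : q * X_ mu ^+ m != 0.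
  by apply: contraNneq p0 => q0; rewrite pq exprSr mulrA q0 mul0r.
rewrite ltnS in sp; apply: IH E _ => //; apply: leq_trans sp.
by rewrite pq exprSr mulrA [ltnRHS]size_Mmonic ?monicXsubC // size_XsubC addn2.
Qed.

(* Multiplying f by a polynomial in c - mu inverts the power series whose
   coefficients are the numbers v (c - mu)^s f. *)
Lemma chain_normalize (mu : K) m (v : 'rV[K]_n.+1) (f : 'cV[K]_n.+1) :
  v *m h (X_ mu ^+ m.+1) = 0 -> h (X_ mu ^+ m.+1) *m f = 0 ->
  v *m h (X_ mu ^+ m) *m f != 0 ->
  exists p, jordan_chain c mu m.+1 v (h p *m f).
Proof.
move=> v0 f0 vf0; 
(* [ok p k] says that the pairing is right for all exponents from [m - k] on; each induction step
   corrects one more exponent. *)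
pose ok p k := forall s, (m <= s + k)%N ->
  v *m h (X_ mu ^+ s) *m (h p *m f) = (s == m)%:R%:M.
suff /(_ m)[p Hp] : forall k, exists p, ok p k.
  exists p; split=> [//||s]; first by rewrite mulmxA horner_mxC -mulmxA f0 mulmx0.
  by apply: Hp; rewrite leq_addl.
have v0' s : (m < s)%N -> v *m h (X_ mu ^+ s) = 0.
  by move=> /subnKC <-; rewrite exprD horner_mxM mulmxA v0 mul0mx.
elim=> [|k [p IH]].
  have [w Ew] : exists w, v *m h (X_ mu ^+ m) *m f = w%:M.
    by exists ((v *m h (X_ mu ^+ m) *m f) 0 0); exact: mx11_scalar.
  exists (w^-1)%:P => s; rewrite addn0 leq_eqVlt => /predU1P[<-|ms]; last first.
    by rewrite v0' // mul0mx gtn_eqF // raddf0.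
  rewrite horner_mx_C mul_scalar_mx -scalemxAr Ew scale_scalar_mx eqxx mulVf //.
  by apply: contraNneq vf0 => w0; rewrite Ew w0 raddf0.
(* [w] is the unwanted value at exponent [m - (k + 1)]. If [k + 1] exceeds [m] the subtraction is
   truncated, but then the correction pairs to zero anyway. *)
pose w := (v *m h (X_ mu ^+ (m - k.+1)) *m (h p *m f)) 0 0.
exists (p - w *: (X_ mu ^+ k.+1 * p)) => s mk.
rewrite rmorphB /= linearZ /= horner_mxM mulmxBl mulmxBr -scalemxAl -scalemxAr.
rewrite -(mulmxA _ (h p)) (mulmxA _ (h (_ ^+ k.+1))).
rewrite -(mulmxA v _ (h (_ ^+ k.+1))) -horner_mxM -exprD.
rewrite (IH (s + k.+1)%N); last by lia.
have [e|ne] := eqVneq (s + k.+1)%N m.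
  have -> : s = (m - k.+1)%N by lia.
  rewrite [v *m _ *m _]mx11_scalar -/w scale_scalar_mx mulr1 subrr.
  by rewrite -e [_ == _]ltn_eqF ?raddf0 //; lia.
rewrite IH; last by lia.
by rewrite /= raddf0 scaler0 subr0.
Qed.

Lemma jordan_chain_exists (e : 'M[K]_n.+1) :
  e != 0 -> e *m e = e -> e *m c = c *m e ->
  exists mu l v f, [/\ jordan_chain c mu l.+1 v f, v *m e = v & e *m f = f].
Proof.
move=> e0 ee ec; have eh := horner_mx_commr ec.
have [mu [m [q [/Bezout_eq1_coprimepP[u u1] q1 q0]]]] := annihilator_split e0.
(* Otherwise the Bezout relation between [q] and ['X - mu], multiplied by [q * X_ mu ^+ m], would
   contradict [q0], its other term being killed by [q1]. *)
have Y0 : h (q * X_ mu ^+ m * q) *m e != 0.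
  apply: contraNneq q0 => Y0; rewrite -[q * _]mul1r -u1 mulrDl rmorphD mulmxDl /=.
  rewrite -2!mulrA horner_mxM -mulmxA [q * _]mulrC Y0 mulmx0 add0r.
  by rewrite (mulrCA (X_ mu)) -exprS horner_mxM -mulmxA q1 mulmx0.
(* A nonzero entry chooses a row of [e *m h q] and a column of [h q *m e] with nonzero pairing
   through [(c - mu)^m]; the factors [q] make them vanish under [(c - mu)^(m + 1)]. *)
have [i [j Yij]] := matrix0Pn _ Y0.
pose v : 'rV_n.+1 := delta_mx 0 i *m (e *m h q).
pose f : 'cV_n.+1 := h q *m e *m delta_mx j 0.
have ve : v *m e = v by rewrite /v -!mulmxA -eh (mulmxA e e) ee.
have ef : e *m f = f by rewrite /f !mulmxA eh -(mulmxA (h q) e e) ee.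
have [|||p ch] := @chain_normalize mu m v f.
- by rewrite /v -!mulmxA -horner_mxM eh q1 mulmx0.
- by rewrite /f !mulmxA horner_mxC -horner_mxM q1 mul0mx.
- have -> : v *m h (X_ mu ^+ m) *m f = (delta_mx 0 i : 'rV_n.+1)
      *m (h (q * X_ mu ^+ m * q) *m e) *m (delta_mx j 0 : 'cV_n.+1).
    rewrite /v /f !horner_mxM eh !mulmxA -(mulmxA _ e (h (X_ mu ^+ m))) eh !mulmxA.
    by rewrite -(mulmxA _ e (h q)) eh !mulmxA -(mulmxA _ e e) ee.
  apply: contraNneq Yij => /matrixP/(_ 0 0).
  by rewrite -rowE -colE !mxE => ->.
by exists mu, m, v, (h p *m f); split; rewrite // mulmxA eh -mulmxA ef.
Qed.

Definition jordan_system (e : 'M[K]_n.+1) b (mu : 'I_b -> K) (l : 'I_b -> nat)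
    (v : 'I_b -> 'rV[K]_n.+1) (f : 'I_b -> 'cV[K]_n.+1) :=
  [/\ forall i, [/\ jordan_chain c (mu i) (l i) (v i) (f i),
                    v i *m e = v i & e *m f i = f i],
      forall i j p, i != j -> v i *m h p *m f j = 0
    & \sum_i chain_idem c (mu i) (l i) (v i) (f i) = e].

Definition fcons T b (x : T) (g : 'I_b -> T) (i : 'I_b.+1) : T :=
  if unlift ord0 i is Some j then g j else x.

(** Induction on the rank: the complement [e'] of a chain idempotent in [e] is again an idempotent
    commuting with [c]. Chains inside [e'] are orthogonal to the first one because [v *m e' = 0] and
    [e' *m f = 0]. *)
Lemma jordan_system_exists (e : 'M[K]_n.+1) :
  e *m e = e -> e *m c = c *m e -> exists b mu l v f, @jordan_system e b mu l v f.
Proof.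
have [N] := ubnP (\rank e); elim: N e => // N IH e re ee ec.
have [->|e0] := eqVneq e 0.
  exists 0%N, (fun=> 0), (fun=> 0%N), (fun=> 0), (fun=> 0).
  by split=> [[]|[]|]; rewrite ?big_ord0.
have [mu [l [v [f [ch ve ef]]]]] := jordan_chain_exists e0 ee ec.
pose e1 := chain_idem c mu l.+1 v f; pose e' := e - e1.
have ee1 : e *m e1 = e1.
  rewrite mulmx_sumr; apply: eq_bigr => a _.
  by rewrite !mulmxA (horner_mx_commr ec) -(mulmxA _ e) ef.
have e1e : e1 *m e = e1.
  rewrite mulmx_suml; apply: eq_bigr => a _.
  by rewrite -!mulmxA -(horner_mx_commr ec) (mulmxA v e) ve.
have e'e : e' *m e = e' by rewrite mulmxBl ee e1e.
have ee' : e *m e' = e' by rewrite mulmxBr ee ee1.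
have e'e' : e' *m e' = e'.
  by rewrite {1}/e' mulmxBl ee' {2}/e' mulmxBr e1e chain_idem_idem // subrr subr0.
have e'c : e' *m c = c *m e'.
  by rewrite mulmxBl mulmxBr ec chain_idem_comm.
have ve' : v *m e' = 0 by rewrite mulmxBr ve chain_idem_row // subrr.
have e'f : e' *m f = 0 by rewrite mulmxBl ef chain_idem_col // subrr.
have re' : (\rank e' < N)%N.
  rewrite ltnS in re; apply: leq_trans re; apply: rank_ltmx.
  (* If the rank did not drop, [e = D *m e'] would give [e *m e' = e], hence [v = v *m e' = 0],
     against the pairing at exponent [l]. *)
  rewrite ltmxE -{1}e'e submxMl /=; apply/negP => /submxP[D De].
  have v0 : v = 0 by rewrite -ve De -e'e' (mulmxA D) -De ee' ve'.
  have [_ _ /(_ l)] := ch; rewrite v0 !mul0mx eqxx => /matrixP/(_ 0 0)/eqP.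
  by rewrite !mxE eq_sym oner_eq0.
have [b [mu1 [l1 [v1 [f1 [sys1 orth1 sum1]]]]]] := IH e' re' e'e' e'c.
pose Mu := fcons mu mu1; pose L := fcons l.+1 l1.
exists b.+1, Mu, L, (fcons v v1), (fcons f f1).
have [fl0 flS] : (forall T (x : T) g, @fcons T b x g ord0 = x) /\
    (forall T (x : T) g i, @fcons T b x g (lift ord0 i) = g i).
  by split=> *; rewrite /fcons ?unlift_none ?liftK.
split.
- move=> i; case: (unliftP ord0 i) => [j|] ->; rewrite /Mu /L ?flS ?fl0 //.
  have [chj vj fj] := sys1 j; split=> //; first by rewrite -vj -mulmxA e'e.
  by rewrite -fj mulmxA ee'.
- move=> i j p; case: (unliftP ord0 i) => [i1|] ->; case: (unliftP ord0 j) => [j1|] ->;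
    rewrite ?flS ?fl0 //.
  + by rewrite (inj_eq lift_inj); exact: orth1.
  + have [_ vi _] := sys1 i1; rewrite -vi => _.
    by rewrite -(mulmxA _ e') (horner_mx_commr e'c) -!mulmxA e'f !mulmx0.
  + have [_ _ fj] := sys1 j1; rewrite -fj => _.
    by rewrite mulmxA -(mulmxA v) -(horner_mx_commr e'c) !mulmxA ve' !mul0mx.
rewrite big_ord_recl /Mu /L !fl0.
under eq_bigr => i _ do rewrite !flS.
by rewrite sum1 addrC subrK.
Qed.

End JordanSystem.

(** * The cells of the commutant of a matrix *)

Section MatrixCells.

Variables (K : closedFieldType) (n : nat) (c : 'M[K]_n.+1).
Variables (b : nat) (mu : 'I_b -> K) (l : 'I_b -> nat).
Variables (v : 'I_b -> 'rV[K]_n.+1) (f : 'I_b -> 'cV[K]_n.+1).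
Hypothesis sys : jordan_system c 1%:M mu l v f.

Local Notation h := (horner_mx c).
Local Notation X_ mu := ('X - mu%:P).

(* Locked, so that rewriting does not unfold these vectors into products. *)
Definition jrow i a := locked (v i *m h (X_ (mu i) ^+ a)).
Definition jcol i a := locked (h (X_ (mu i) ^+ a) *m f i).

Lemma jrowE i a : jrow i a = v i *m h (X_ (mu i) ^+ a).
Proof. by rewrite /jrow -lock. Qed.

Lemma jcolE i a : jcol i a = h (X_ (mu i) ^+ a) *m f i.
Proof. by rewrite /jcol -lock. Qed.

Let chains i : jordan_chain c (mu i) (l i) (v i) (f i).
Proof. by have [+ _ _] := sys => /(_ i)[]. Qed.

Lemma jrow0 i a : (l i <= a)%N -> jrow i a = 0.
Proof. by rewrite jrowE; exact: chain_row_ge0. Qed.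

Lemma jcol0 i a : (l i <= a)%N -> jcol i a = 0.
Proof. by rewrite jcolE; exact: chain_col_ge0. Qed.

Lemma jrow_jcol i a j d :
  jrow i a *m jcol j d = ((i == j) && ((a + d).+1 == l i))%:R%:M.
Proof.
rewrite jrowE jcolE mulmxA -(mulmxA (v i)) -horner_mxM.
have [<-|ij] := eqVneq i j; first by rewrite -exprD (chain_pair (chains i)).
by have [_ -> //] := sys; rewrite raddf0.
Qed.

Lemma jcol_jrow_sum : \sum_i \sum_(a < l i) jcol i (l i - a.+1) *m jrow i a = 1%:M.
Proof.
have [_ _ <-] := sys; apply: eq_bigr => i _; apply: eq_bigr => a _.
by rewrite jrowE jcolE.
Qed.

(* For U_i = K[x]/(x^(l i)), this is the composite of the canonical maps
   between U_i and U_j through K[x]/(x^(t + 1)). *)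
Definition cellmx t i j : 'M[K]_n.+1 :=
  \sum_(a < t.+1) jcol i (l i - a.+1) *m jrow j (l j - t.+1 + a).

(** Transposition swaps the factors of each summand, so the flip of a cell matrix appears with this
    order of summation. *)
Lemma cellmx_rev t i j : (t < l i)%N -> (t < l j)%N ->
  cellmx t i j = \sum_(a < t.+1) jcol i (l i - t.+1 + a) *m jrow j (l j - a.+1).
Proof.
move=> ti tj; rewrite /cellmx (reindex_inj rev_ord_inj); apply: eq_bigr => a _ /=.
have ha := ltn_ord a; congr (jcol i _ *m jrow j _); lia.
Qed.

(** Only the summand [a = t - s] survives. The image depends on [j] through the condition alone,
    which gives the independence required in (C3). *)
Lemma cellmx_jcol t i j k s : (t < l j)%N ->
  cellmx t i j *m jcol k s =
  if (j == k) && (s <= t)%N then jcol i (l i - (t - s).+1) else 0.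
Proof.
move=> tj; rewrite mulmx_suml.
have E (a : 'I_t.+1) : jcol i (l i - a.+1) *m jrow j (l j - t.+1 + a) *m jcol k s =
    ((j == k) && (a + s == t)%N)%:R *: jcol i (l i - a.+1).
  rewrite -mulmxA jrow_jcol mul_mx_scalar; congr (_%:R *: _).
  by congr (nat_of_bool (_ && _)); apply/eqP/eqP; lia.
rewrite (eq_bigr _ (fun a _ => E a)); case: eqVneq => [_|_] /=; last first.
  by rewrite big1 // => a _; rewrite scale0r.
case: leqP => [st|ts]; last first.
  by rewrite big1 // => a _; rewrite gtn_eqF ?scale0r // ltn_addl.
have ht : (t - s < t.+1)%N by rewrite ltnS leq_subr.
rewrite (bigD1 (Ordinal ht)) //= subnK // eqxx scale1r big1 ?addr0 // => a.
rewrite -val_eqE /= => /eqP ne; case: eqP => [e|]; last by rewrite scale0r.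
by case: ne; lia.
Qed.

(** These functionals are dual to the cell matrices and serve below as coordinates. *)
Lemma cellmx_coord t i j k m s : (t < l i)%N -> (t < l j)%N ->
  v k *m cellmx t i j *m jcol m s = [&& k == i, j == m & s == t]%:R%:M.
Proof.
move=> ti tj; rewrite -mulmxA cellmx_jcol //.
have vk : v k = jrow k 0 by rewrite jrowE expr0 rmorph1 mulmx1.
case: eqVneq => [_|_] /=; last by rewrite andbF mulmx0 raddf0.
case: (leqP s t) => [st|ts]; last by rewrite gtn_eqF // andbF mulmx0 raddf0.
rewrite vk jrow_jcol; congr (_%:R%:M); congr (nat_of_bool _).
case: eqVneq => [->|//] /=; apply/eqP/eqP; lia.
Qed.

(** With a common eigenvalue, [c - mu i] shifts the columns of block [i] and the rows of block [j]
    alike; the extreme terms reach the exponents [l i] and [l j] and vanish. *)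
Lemma cellmx_comm t i j : mu i = mu j -> (t < l i)%N -> (t < l j)%N ->
  cellmx t i j *m c = c *m cellmx t i j.
Proof.
move=> mij ti tj.
suff E : cellmx t i j *m h (X_ (mu i)) = h (X_ (mu i)) *m cellmx t i j.
  move: E; rewrite rmorphB /= horner_mx_X horner_mx_C mulmxBr mulmxBl.
  by rewrite scalar_mxC => /addIr.
have rowS a : jrow j a *m h (X_ (mu i)) = jrow j a.+1.
  by rewrite mij !jrowE -mulmxA -horner_mxM -exprSr.
have colS a : h (X_ (mu i)) *m jcol i a = jcol i a.+1.
  by rewrite !jcolE mulmxA -horner_mxM -exprS.
rewrite /cellmx mulmx_suml mulmx_sumr big_ord_recr [RHS]big_ord_recl /=.
rewrite -mulmxA rowS jrow0 ?mulmx0 ?addr0; last by lia.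
rewrite mulmxA colS jcol0 ?mul0mx ?add0r; last by lia.
apply: eq_bigr => a _; rewrite -mulmxA rowS mulmxA colS /bump leq0n add1n.
by have ha := ltn_ord a; congr (jcol i _ *m jrow j _); lia.
Qed.

(** Powers of ['X - mu i] and ['X - mu j] are coprime; one kills [v i], the other [f j], and both
    pass through [X]. *)
Lemma commutant_pair0 (X : 'M[K]_n.+1) i j :
  X *m c = c *m X -> mu i != mu j -> v i *m X *m f j = 0.
Proof.
move=> Xc mij; have Xh := horner_mx_commr Xc.
have /Bezout_eq1_coprimepP[u u1] : coprimep (X_ (mu i) ^+ l i) (X_ (mu j) ^+ l j).
  by apply/coprimep_expl/coprimep_expr/coprimep_XsubC2; rewrite subr_eq0 eq_sym.
rewrite -[f j]mul1mx -[1%:M](rmorph1 h) -u1 rmorphD /= mulmxDl mulmxDr !horner_mxM.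
rewrite -(mulmxA (h u.2)) (chain_col0 (chains j)) !mulmx0 addr0.
by rewrite horner_mxC !mulmxA -(mulmxA (v i)) Xh !mulmxA (chain_row0 (chains i)) !mul0mx.
Qed.

(** All entries of [X] in the dual Jordan bases reduce to those in the hypothesis: powers of
    [c - mu i] move from the row across [X] to the column. An exponent beyond [l j] kills the
    column, and one beyond [l i] kills the row after moving back. *)
Lemma commutant_eq0 (X : 'M[K]_n.+1) : X *m c = c *m X ->
  (forall i j t, mu i = mu j -> (t < l i)%N -> (t < l j)%N ->
     v i *m X *m jcol j t = 0) -> X = 0.
Proof.
move=> Xc X0; have Xh := horner_mx_commr Xc.
have rXc i a j d : jrow i a *m X *m jcol j d = 0.
  have [mij|mij] := eqVneq (mu i) (mu j); last first.
    have ch := horner_mx_commr (erefl (c *m c)).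
    have -> : jrow i a *m X *m jcol j d =
        v i *m (h (X_ (mu i) ^+ a) *m X *m h (X_ (mu j) ^+ d)) *m f j.
      by rewrite jrowE jcolE !mulmxA.
    apply: commutant_pair0 => //; rewrite -(mulmxA _ _ c) -ch !mulmxA.
    by rewrite -(mulmxA _ X c) Xc !mulmxA ch.
  have -> : jrow i a *m X *m jcol j d = v i *m X *m jcol j (a + d)%N.
    by rewrite jrowE !jcolE -mij -(mulmxA (v i)) -Xh exprD horner_mxM !mulmxA.
  have [tj|tj] := ltnP (a + d) (l j); last by rewrite jcol0 // mulmx0.
  have [ti|ti] := ltnP (a + d) (l i); first exact: X0.
  rewrite jcolE -mij mulmxA -(mulmxA (v i)) Xh mulmxA.
  by rewrite -jrowE jrow0 // !mul0mx.
rewrite -[X]mul1mx -[LHS]mulmx1 -jcol_jrow_sum mulmx_sumr big1 // => j _.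
rewrite mulmx_sumr big1 // => d _; rewrite !mulmx_suml big1 // => i _.
rewrite !mulmx_suml big1 // => a _.
by rewrite !mulmxA -(mulmxA _ _ X) -(mulmxA _ (_ *m X) (jcol _ _)) rXc mulmx0 mul0mx.
Qed.

(* The flip is the adjunction for the symmetric bilinear form that pairs the
   a-th and the (l i - 1 - a)-th vectors of the i-th Jordan block. *)
Definition flip_col := \sum_i \sum_(a < l i) jcol i (l i - a.+1) *m (jcol i a)^T.
Definition flip_row := \sum_i \sum_(a < l i) (jrow i a)^T *m jrow i (l i - a.+1).

Definition flip (X : 'M[K]_n.+1) := flip_col *m X^T *m flip_row.

Lemma flip_linear : linear flip.
Proof.
by move=> k X Y; rewrite /flip linearP mulmxDr mulmxDl -scalemxAr -scalemxAl.
Qed.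

HB.instance Definition _ := GRing.isLinear.Build K _ _ _ flip flip_linear.

Lemma jrow_flip_col i s : (s < l i)%N -> jrow i s *m flip_col = (jcol i s)^T.
Proof.
move=> si; rewrite mulmx_sumr (bigD1 i) //=.
rewrite [X in _ + X]big1 ?addr0 => [|j ji]; last first.
  rewrite mulmx_sumr big1 // => a _.
  by rewrite mulmxA jrow_jcol eq_sym (negbTE ji) mul_scalar_mx scale0r.
rewrite mulmx_sumr (bigD1 (Ordinal si)) //= big1 ?addr0 => [|a].
  rewrite mulmxA jrow_jcol eqxx (_ : _ == l i) ?mul1mx //; apply/eqP; lia.
rewrite -val_eqE /= => /eqP ne; rewrite mulmxA jrow_jcol eqxx.
case: eqP => [e|_]; last by rewrite mul_scalar_mx scale0r.
by case: ne; have := ltn_ord a; lia.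
Qed.

Lemma flip_col_tr : flip_col^T = flip_col.
Proof.
rewrite /flip_col linear_sum; apply: eq_bigr => i _.
rewrite linear_sum (reindex_inj rev_ord_inj); apply: eq_bigr => a _ /=.
rewrite trmx_mul trmxK; have ha := ltn_ord a.
by congr (jcol i _ *m (jcol i _)^T); lia.
Qed.

Lemma flip_col_jrow i s : (s < l i)%N -> flip_col *m (jrow i s)^T = jcol i s.
Proof.
by move=> si; apply: trmx_inj; rewrite trmx_mul trmxK flip_col_tr jrow_flip_col.
Qed.

Lemma jcol_flip_row i s : (s < l i)%N -> (jcol i s)^T *m flip_row = jrow i s.
Proof.
move=> si; rewrite mulmx_sumr (bigD1 i) //=.
rewrite [X in _ + X]big1 ?addr0 => [|j ji]; last first.
  rewrite mulmx_sumr big1 // => a _.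
  by rewrite mulmxA -trmx_mul jrow_jcol (negbTE ji) tr_scalar_mx mul_scalar_mx scale0r.
have hs : (l i - s.+1 < l i)%N by lia.
rewrite mulmx_sumr (bigD1 (Ordinal hs)) //= big1 ?addr0 => [|a].
  rewrite mulmxA -trmx_mul jrow_jcol eqxx tr_scalar_mx (_ : _ == l i); last first.
    by apply/eqP; lia.
  by rewrite mul1mx; congr jrow; lia.
rewrite -val_eqE /= => /eqP ne; rewrite mulmxA -trmx_mul jrow_jcol eqxx tr_scalar_mx.
case: eqP => [e|_]; last by rewrite mul_scalar_mx scale0r.
by case: ne; lia.
Qed.

(** The product is the transpose of the resolution of the identity [jcol_jrow_sum]. It cancels the
    inner factors in [flipM]. *)
Lemma flip_rowK : flip_row *m flip_col = 1%:M.
Proof.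
rewrite mulmx_suml -[RHS]trmx1 -jcol_jrow_sum linear_sum; apply: eq_bigr => i _.
rewrite mulmx_suml linear_sum; apply: eq_bigr => a _.
by rewrite /= trmx_mul -mulmxA jrow_flip_col //; have := ltn_ord a; lia.
Qed.

Lemma flipM X Y : flip (X *m Y) = flip Y *m flip X.
Proof.
by rewrite /flip trmx_mul !mulmxA -[X in _ = X *m _ *m _]mulmxA flip_rowK mulmx1.
Qed.

Lemma flip_cellmx t i j : (t < l i)%N -> (t < l j)%N ->
  flip (cellmx t i j) = cellmx t j i.
Proof.
move=> ti tj; rewrite (cellmx_rev tj ti) /cellmx linear_sum; apply: eq_bigr => a _ /=.
have ha := ltn_ord a; rewrite /flip trmx_mul !mulmxA flip_col_jrow; last by lia.
by rewrite -mulmxA jcol_flip_row //; lia.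
Qed.

(** A pair consists of [t], standing for the quotient K[x]/(x^(t+1)), and an eigenvalue. If no block
    with this eigenvalue is longer than [t], the index type of the cell is empty. *)
Definition cell_poset_type : finType := ('I_(\max_i l i) * seq_sub (codom mu))%type.
Definition cell_poset := ranked (fun p : cell_poset_type => val p.1).
Definition cell_index (p : cell_poset) : finType :=
  {i : 'I_b | (val p.1 < l i)%N && (mu i == val p.2)}.

Lemma cell_index_lt (p : cell_poset) (i : cell_index p) : (val p.1 < l (val i))%N.
Proof. by case/andP: (valP i). Qed.

Lemma cell_index_mu (p : cell_poset) (i : cell_index p) : mu (val i) = val p.2.
Proof. by case/andP: (valP i) => _ /eqP. Qed.

Fact cellmx_centralizes (p : cell_poset) (i j : cell_index p) :
  cellmx (val p.1) (val i) (val j) \in centralizes c.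
Proof.
rewrite unfold_in; apply/eqP; apply: cellmx_comm; rewrite ?cell_index_lt //.
by rewrite !cell_index_mu.
Qed.

Definition cell (p : cell_poset) (i j : cell_index p) : centralizer c :=
  Centralizer (cellmx_centralizes i j).

Definition coord (p : cell_poset) (i j : cell_index p) (X : centralizer c) : K :=
  (v (val i) *m val X *m jcol (val j) (val p.1)) 0 0.

Fact coord_scalar p i j : scalar (@coord p i j).
Proof.
by move=> k X Y; rewrite /coord /= mulmxDr mulmxDl -scalemxAr -scalemxAl !mxE.
Qed.

HB.instance Definition _ p i j :=
  GRing.isLinear.Build K _ _ _ (@coord p i j) (@coord_scalar p i j).

Lemma cell_index_inj (p q : cell_poset) (i : cell_index p) (j : cell_index q) :
  val i = val j -> val p.1 = val q.1 -> p = q.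
Proof.
case: p q i j => [t z] [t' z'] i j ij /= tt'.
congr pair; first exact: val_inj.
by apply: val_inj; rewrite -(cell_index_mu i) -(cell_index_mu j) ij.
Qed.

Lemma coord_cell (p q : cell_poset) (i j : cell_index p) (k m : cell_index q) :
  coord k m (cell i j) =
  [&& val k == val i, val j == val m & val q.1 == val p.1]%:R.
Proof. by rewrite /coord cellmx_coord ?cell_index_lt // mxE eqxx mulr1n. Qed.

Lemma coord_lincomb (Q : pred cell_poset) k (p : cell_poset) (i j : cell_index p) :
  coord i j (cell_lincomb cell Q k) = if Q p then k p i j else 0.
Proof.
have coordE q : coord i j (\sum_x \sum_y k q x y *: cell x y) =
    \sum_x \sum_y k q x y * [&& val i == val x, val y == val j & val p.1 == val q.1]%:R.
  rewrite raddf_sum; apply: eq_bigr => x _; rewrite raddf_sum; apply: eq_bigr => y _.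
  by rewrite -coord_cell; exact: scalarZ.
have ne q : q != p -> coord i j (\sum_x \sum_y k q x y *: cell x y) = 0.
  move=> qp; rewrite coordE big1 // => x _; rewrite big1 // => y _.
  case: and3P => [[/eqP ix _ /eqP pq]|_]; last by rewrite mulr0.
  by case/eqP: qp; apply/esym/(cell_index_inj ix pq).
rewrite raddf_sum; case: ifPn => [Qp|nQp]; last first.
  by rewrite big1 // => q Qq; apply: ne; apply: contraNneq nQp => <-.
rewrite (bigD1 p) //= [X in _ + X]big1 ?addr0 => [|q /andP[_ /ne]//].
rewrite coordE (bigD1 i) //= [X in _ + X]big1 ?addr0 => [|x xi]; last first.
  by rewrite big1 // => y _; rewrite (inj_eq val_inj) eq_sym (negbTE xi) mulr0.
rewrite (bigD1 j) //= [X in _ + X]big1 ?addr0 => [|y yj]; last first.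
  by rewrite (inj_eq val_inj y) (negbTE yj) andbF mulr0.
by rewrite !eqxx mulr1.
Qed.

(** By duality the difference of the two sides has all coordinates zero, so [commutant_eq0] applies
    to it. *)
Lemma cell_expansion (X : centralizer c) :
  X = cell_lincomb cell predT (fun p i j => coord i j X).
Proof.
apply/eqP; rewrite -subr_eq0; apply/eqP; set Y := X - _.
apply: val_inj; apply: commutant_eq0 => [|i j t mij ti tj].
  by apply/eqP; exact: (centralizerP Y).
have tL : (t < \max_i l i)%N by apply: leq_trans ti (leq_bigmax _).
pose p : cell_poset := (Ordinal tL, SeqSub (codom_f mu i)).
have iP : (val p.1 < l i)%N && (mu i == val p.2) by rewrite /= ti eqxx.
have jP : (val p.1 < l j)%N && (mu j == val p.2) by rewrite /= tj mij eqxx.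
have -> : v i *m val Y *m jcol j t = (coord (Sub i iP : cell_index p) (Sub j jP) Y)%:M.
  exact: mx11_scalar.
by rewrite raddfB /= coord_lincomb subrr raddf0.
Qed.

(** Swapping coordinates keeps the result in the commutant by construction; [val_cell_flip] then
    identifies it with [flip], which supplies antimultiplicativity. *)
Definition cell_flip (X : centralizer c) : centralizer c :=
  cell_lincomb cell predT (fun p i j => coord j i X).

Lemma cell_lincomb_ext (Q : pred cell_poset) k k' :
  (forall p (i j : cell_index p), Q p -> k p i j = k' p i j) ->
  cell_lincomb cell Q k = cell_lincomb cell Q k'.
Proof.
move=> kk'; apply: eq_bigr => p Qp; apply: eq_bigr => i _; apply: eq_bigr => j _.
by rewrite kk'.
Qed.

Lemma val_cell_flip X : val (cell_flip X) = flip (val X).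
Proof.
rewrite [X in flip (val X)]cell_expansion /cell_lincomb !raddf_sum.
apply: eq_bigr => p _; rewrite exchange_big !raddf_sum; apply: eq_bigr => i _.
rewrite !raddf_sum; apply: eq_bigr => j _.
have := linearZ_LR (flip : {linear _ -> _}) (coord i j X) (val (cell i j)).
by rewrite /= flip_cellmx ?cell_index_lt // => E; exact: esym E.
Qed.

Fact cell_flip_linear : linear cell_flip.
Proof. by move=> k X Y; apply: val_inj; rewrite /= !val_cell_flip linearP. Qed.

HB.instance Definition _ := GRing.isLinear.Build K _ _ _ cell_flip cell_flip_linear.

Lemma centralizer_cell_datum : is_cell_datum cell (cell_flip : {linear _ -> _}).
Proof.
split.
- split=> [X|k k0 p i j]; first by eexists; exact: cell_expansion.
  by rewrite -[LHS](coord_lincomb predT k) k0 raddf0.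
- split=> [X Y|X|p i j].
  + by apply: val_inj; rewrite /= !val_cell_flip flipM.
  + rewrite [RHS]cell_expansion; apply: cell_lincomb_ext => p i j _.
    by rewrite coord_lincomb.
  + by apply: val_inj; rewrite val_cell_flip flip_cellmx ?cell_index_lt.
move=> X p.
(* This is the coordinate of [X * cell i j] at [(u, j)] in the cell [p]: by [cellmx_jcol] with
   [s = t], the cell matrix maps the column of block [j] to the last one of block [i]. *)
exists (fun u i => (v (val u) *m val X *m jcol (val i) (l (val i)).-1) 0 0) => i j.
exists (fun q u w => coord u w (X * cell i j)).
have coordE q (u w : cell_index q) : coord u w (X * cell i j) =
    if (val j == val w) && (val q.1 <= val p.1)%N then
      (v (val u) *m val X *m jcol (val i) (l (val i) - (val p.1 - val q.1).+1)) 0 0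
    else 0.
  rewrite /coord /= mulmxA -mulmxA cellmx_jcol ?cell_index_lt //.
  by case: ifP => // _; rewrite mulmx0 mxE.
rewrite [LHS]cell_expansion {1}/cell_lincomb (bigD1 p) //=; congr (_ + _).
  apply: eq_bigr => u _; rewrite (bigD1 j) //= [X in _ + X]big1 ?addr0 => [|w wj].
    by rewrite coordE eqxx leqnn subnn subn1.
  by rewrite coordE (inj_eq val_inj) eq_sym (negbTE wj) scale0r.
(* A nonzero coordinate at [q != p] has second block [j] and [q.1] at most [p.1]. Equality is
   excluded, since block [j] determines the eigenvalue and would force [q = p]. *)
rewrite big_mkcond [RHS]big_mkcond; apply: eq_bigr => q _ /=.
case: ifPn => [qp|/negPn/eqP->]; last by rewrite ltxx.
case: ifPn => // nqp; rewrite big1 // => u _; rewrite big1 // => w _.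
rewrite coordE; case: andP => [[/eqP jw qlep]|_]; last by rewrite scale0r.
have ltqp : ((q : cell_poset) < p)%O = (val q.1 < val p.1)%N by [].
case/negP: nqp; rewrite ltqp ltn_neqAle qlep andbT.
by apply: contraNneq qp => e; apply/eqP/esym/(cell_index_inj jw).
Qed.

End MatrixCells.

Lemma cellular_centralizer_mx (K : closedFieldType) n (c : 'M[K]_n.+1) :
  cellular (centralizer c).
Proof.
have [|b [mu [l [v [f sys]]]]] := @jordan_system_exists _ _ c 1%:M (mul1mx _).
  by rewrite mul1mx mulmx1.
by do 5!eexists; exact: centralizer_cell_datum sys.
Qed.

Theorem corollary4p6 (R : closedFieldType) :
  (forall (n : nat) (c : 'M[R]_n.+1), cellular (centralizer c)) /\
  (forall (s : nat) (n : 'I_s.+1 -> nat)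
     (c : alg_prod (fun i => 'M[R]_((n i).+1))), cellular (centralizer c)).
Proof.
split=> [n c|s n c]; first exact: cellular_centralizer_mx.
by apply: cellular_centralizer_alg_prod => i; exact: cellular_centralizer_mx.
Qed.
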